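(* Consider the classical backwards continued fraction expansion of irrational numbers $x_0\in(0,1)$, and let $\theta_n(x_0)=q_n^2\left|x_0-\frac{p_n}{q_n}\right|$, $n\ge1$, be its sequence of approximation coefficients. Then there is no constant $C$ such that $\theta_n(x_0)<C$ for all irrational $x_0\in(0,1)$ and all $n\ge1$; however, $|\theta_{n+1}(x_0)-\theta_n(x_0)|<1$ for all irrational $x_0\in(0,1)$ and all $n\ge1$.
   Context: The backwards continued fraction expansion of an irrational $x_0\in(0,1)$ is the unique expansion $x_0=1-\cfrac{1}{b_1+1-\cfrac{1}{b_2+1-\cfrac{1}{b_3+\cdots}}}$ with positive integer digits $b_n$ (equivalently, the expansion generated by iterating $T(x)=\frac{x}{1-x}-\left\lfloor\frac{x}{1-x}\right\rfloor$). Its $n$th convergent $\frac{p_n}{q_n}$ (with $\gcd(p_n,q_n)=1$, $q_n>0$) is the rational number obtained by truncating the expansion after the digit $b_n$, i.e. $1-\cfrac{1}{b_1+1-\cfrac{1}{\ddots\, b_{n-1}+1-\cfrac{1}{b_n+1}}}$. *)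

(* Defs.v *)
From mathcomp Require Import all_boot all_order all_algebra.
From mathcomp Require Import all_classical all_reals.
From mathcomp Require Import ring.

Set Implicit Arguments.
Unset Strict Implicit.
Unset Printing Implicit Defensive.

Import Order.TTheory GRing.Theory Num.Theory.

Local Open Scope ring_scope.

Definition bcf_map (R : realType) (x : R) : R :=
  x / (1 - x) - (Num.floor (x / (1 - x)))%:~R.

Definition bcf_orbit (R : realType) (x : R) (n : nat) : R :=
  iter n (@bcf_map R) x.

(* Digits are indexed from n = 1; the value at n = 0 is a junk duplicate of
   the first digit.  Writing x_n for bcf_orbit x n, one has
   x_(n-1) = 1 - 1 / (b_n + x_n) with b_n as below (lemma bcf_orbitS), and
   substituting x_n = 1 - 1 / (b_(n+1) + x_(n+1)) turns the denominator
   b_n + x_n into b_n + 1 - 1 / (b_(n+1) + x_(n+1)). *)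
Definition bcf_digit (R : realType) (x : R) (n : nat) : int :=
  Num.floor (bcf_orbit x n.-1 / (1 - bcf_orbit x n.-1)) + 1.

(* 1 / (b_1 + 1 - 1 / (b_2 + 1 - ... - 1 / (b_n + 1))), and 0 if s is empty *)
Fixpoint bcf_fraction (s : seq int) : rat :=
  if s is b :: s' then (b%:~R + 1 - bcf_fraction s')^-1 else 0.

Definition bcf_convergent (R : realType) (x : R) (n : nat) : rat :=
  1 - bcf_fraction [seq bcf_digit x i | i <- iota 1 n].

Definition bcf_p (R : realType) (x : R) (n : nat) : int :=
  numq (bcf_convergent x n).

Definition bcf_q (R : realType) (x : R) (n : nat) : int :=
  denq (bcf_convergent x n).

Definition bcf_theta (R : realType) (x : R) (n : nat) : R :=
  (bcf_q x n)%:~R ^+ 2 * `|x - (bcf_p x n)%:~R / (bcf_q x n)%:~R|.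

Lemma bcf_orbit_itv (R : realType) (x : R) (n : nat) :
  0 < x < 1 -> 0 <= bcf_orbit x n < 1.
Proof.
move=> /andP[x0 x1]; case: n => [|n]; first by rewrite /bcf_orbit /= ltW.
rewrite /bcf_orbit /= /bcf_map; set y := _ / _.
by rewrite subr_ge0 Num.Theory.floor_le ltrBlDl -intrD1 Num.Theory.floorD1_gt.
Qed.

Lemma bcf_digit_gt0 (R : realType) (x : R) (n : nat) :
  0 < x < 1 -> 0 < bcf_digit x n.
Proof.
move=> /(bcf_orbit_itv n.-1)/andP[o0 o1]; rewrite /bcf_digit ltzD1.
by rewrite Num.Theory.floor_ge0 divr_ge0// subr_ge0 ltW.
Qed.

Lemma bcf_orbitS (R : realType) (x : R) (n : nat) : 0 < x < 1 ->
  bcf_orbit x n = 1 - ((bcf_digit x n.+1)%:~R + bcf_orbit x n.+1)^-1.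
Proof.
move=> /(bcf_orbit_itv n)/andP[_ o1].
have -> : bcf_orbit x n.+1 = bcf_map (bcf_orbit x n) by [].
rewrite /bcf_digit /bcf_map /=; set y := bcf_orbit x n in o1 *.
have y1 : 1 - y != 0 by rewrite subr_eq0 gt_eqF.
set f := Num.floor _; have -> : (f + 1)%:~R + (y / (1 - y) - f%:~R) = (1 - y)^-1.
  by rewrite intrD; field.
by rewrite invrK opprB addrC subrK.
Qed.

(* Main.v *)
Require Import Defs.
From mathcomp Require Import all_boot all_order all_algebra.
From mathcomp Require Import all_classical all_reals.
From mathcomp Require Import ring lra.

Set Implicit Arguments.
Unset Strict Implicit.
Unset Printing Implicit Defensive.

Import Order.TTheory GRing.Theory Num.Theory.

Local Open Scope ring_scope.

(** Put t = 1 - x_n and let P_n, Q_n be the continuants of the digits, so that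
    the n-th convergent is 1 - P_n / Q_n.  Then 1 - x is the Moebius image
    (P_n - P_(n-1) t) / (Q_n - Q_(n-1) t), which has determinant 1, whence
    theta_n = Q_n t / (Q_n - Q_(n-1) t).  With t' = 1 - x_(n+1) this gives
    theta_(n+1) - theta_n = (Q_(n+1) t' - Q_n) / (Q_(n+1) - Q_n t'), of absolute
    value less than 1 because 0 < t' < 1 and Q_n < Q_(n+1).
    If 0 < x < 1 / (2 (n + 1)), the first n digits are 1 and the convergent is
    1 / (n + 1), so theta_n > (n + 1) / 2. *)

(** * Continuants and the Moebius form of a finite expansion *)

Section Continuants.
Variable b : nat -> int.

(* The pair (X_(n-1), X_n) for the recurrence X_n = (b_n + 1) X_(n-1) - X_(n-2). *)
Fixpoint cont (u : int * int) (n : nat) : int * int :=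
  if n is m.+1 then ((cont u m).2, (b n + 1) * (cont u m).2 - (cont u m).1)
  else u.

(** The initial pairs make the empty expansion the identity map:
    [(0 - (-1) * t) / (1 - 0 * t) = t]. *)
Definition contP := cont (-1, 0).
Definition contQ := cont (0, 1).

(** One step of the recurrence multiplies by a matrix of determinant 1. *)
Lemma cont_det n :
  (contP n).2 * (contQ n).1 - (contP n).1 * (contQ n).2 = 1.
Proof. by elim: n => [//|n <-] /=; rewrite -/contP -/contQ; ring. Qed.

Hypothesis b_gt0 : forall n, 0 < b n.

(** As [b n.+1 + 1 >= 2], the increments of Q never decrease, and the first one is 1. *)
Lemma contQ_bounds n : 0 <= (contQ n).1 < (contQ n).2.
Proof.
elim: n => [//|n /andP[h1 h2]]; rewrite /= -/contQ (le_trans h1 (ltW h2)) /=.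
have : 1 <= b n.+1 by rewrite -gtz0_ge1.
by move: h1 h2; move: (contQ n).1 (contQ n).2 (b _) => p q d *; nra.
Qed.

Lemma contQ_sub_gt0 (F : realFieldType) n (t : F) : 0 <= t <= 1 ->
  0 < (contQ n).2%:~R - (contQ n).1%:~R * t.
Proof.
move=> /andP[t0 t1]; have /andP[h1 h2] := contQ_bounds n.
rewrite subr_gt0 (@le_lt_trans _ _ (contQ n).1%:~R) ?ltr_int//.
by rewrite ler_piMr// ler0z.
Qed.

(** The innermost 0 of [bcf_fraction] becomes a free variable over any real field: t = 0 gives
    convergents, t = 1 - x_n gives 1 - x. *)
Definition bcf_tail (F : realFieldType) (s : seq int) (t : F) : F :=
  foldr (fun d z => (d%:~R + 1 - z)^-1) t s.

Lemma bcf_tailS (F : realFieldType) n (t : F) :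
  bcf_tail [seq b i | i <- iota 1 n.+1] t =
  bcf_tail [seq b i | i <- iota 1 n] ((b n.+1)%:~R + 1 - t)^-1.
Proof. by rewrite -[in iota _ _](addn1 n) iotaD map_cat /bcf_tail foldr_cat /= add1n. Qed.

Lemma bcf_tailE (F : realFieldType) n (t : F) : 0 <= t <= 1 ->
  bcf_tail [seq b i | i <- iota 1 n] t =
  ((contP n).2%:~R - (contP n).1%:~R * t) /
  ((contQ n).2%:~R - (contQ n).1%:~R * t).
Proof.
elim: n t => [|n IHn] t t01; first by rewrite /= mul0r mulN1r subr0 opprK divr1 add0r.
have b1 : 1 <= (b n.+1)%:~R :> F by rewrite ler1z -gtz0_ge1.
have d0 : 0 < (b n.+1)%:~R + 1 - t by case/andP: t01 => _ t1; lra.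
(* A further digit substitutes [1 / (b + 1 - t)] for t; this stays in [0, 1] because
   [b + 1 - t >= 1]. *)
rewrite bcf_tailS IHn; last first.
  by case/andP: t01 => _ t1; rewrite invr_ge0 ltW//= invf_le1//; lra.
have := contQ_sub_gt0 n.+1 t01.
rewrite /= -/contP -/contQ !(intrB, intrM, intrD) => /lt0r_neq0 Q0.
by field; rewrite (lt0r_neq0 d0) Q0.
Qed.

End Continuants.

Lemma bcf_fractionE (s : seq int) : bcf_fraction s = bcf_tail s 0.
Proof. by elim: s => //= d s ->. Qed.

(** * Approximation coefficients in terms of continuants *)

Section Theta.
Variables (R : realType) (x : R).
Hypothesis x01 : 0 < x < 1.

Let b := bcf_digit x.
Let Q n : R := (contQ b n).2%:~R.
Let Q' n : R := (contQ b n).1%:~R.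
Let t n : R := 1 - bcf_orbit x n.

Let b_gt0 n : 0 < b n. Proof. exact: bcf_digit_gt0. Qed.

Let t01 n : 0 <= t n <= 1.
Proof. by have /andP[? ?] := bcf_orbit_itv n x01; apply/andP; rewrite /t; lra. Qed.

Lemma bcf_tail_orbit n : bcf_tail [seq b i | i <- iota 1 n] (t n) = 1 - x.
Proof.
elim: n => [|n <-]; first by rewrite /t.
rewrite bcf_tailS; congr bcf_tail; rewrite /t (bcf_orbitS n x01) subKr; congr _^-1; rewrite /b; ring.
Qed.

Lemma bcf_convergentE n :
  bcf_convergent x n = ((contQ b n).2 - (contP b n).2)%:~R / (contQ b n).2%:~R.
Proof.
have /andP[q1 q2] := contQ_bounds b_gt0 n.
rewrite /bcf_convergent bcf_fractionE (bcf_tailE b_gt0) ?lexx ?ler01//.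
rewrite !mulr0 !subr0 intrB mulrBl divff// intr_eq0.
by rewrite gt_eqF// (le_lt_trans q1).
Qed.

Lemma bcf_qE n : bcf_q x n = (contQ b n).2.
Proof.
have /andP[q1 q2] := contQ_bounds b_gt0 n.
have q0 := le_lt_trans q1 q2.
rewrite /bcf_q bcf_convergentE coprimeq_den; first by rewrite gt_eqF// gtr0_norm.
rewrite -coprimezE; apply/coprimezP.
(* The determinant identity, rewritten as a Bezout relation between Q - P and Q. *)
exists (- (contQ b n).1, (contQ b n).1 - (contP b n).1) => /=.
by rewrite -(cont_det b n); ring.
Qed.

Lemma bcf_thetaE n : bcf_theta x n = Q n * t n / (Q n - Q' n * t n).
Proof.
have /andP[q1 q2] := contQ_bounds b_gt0 n.
have Q0 : 0 < Q n by rewrite ltr0z (le_lt_trans q1).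
have D0 : 0 < Q n - Q' n * t n := contQ_sub_gt0 b_gt0 n (t01 n).
have /andP[t0 _] := t01 n.
have det : (contP b n).2%:~R * Q' n - (contP b n).1%:~R * Q n = 1.
  by rewrite /Q /Q' -!intrM -intrB cont_det.
have pq : (bcf_p x n)%:~R / (bcf_q x n)%:~R = 1 - (contP b n).2%:~R / Q n.
  rewrite /bcf_p /bcf_q; transitivity (ratr (bcf_convergent x n) : R).
    by rewrite -[in RHS](divq_num_den (bcf_convergent x n)) fmorph_div /= !ratr_int.
  by rewrite bcf_convergentE fmorph_div /= !ratr_int intrB mulrBl divff// lt0r_neq0.
have xE : x = 1 - ((contP b n).2%:~R - (contP b n).1%:~R * t n) / (Q n - Q' n * t n).
  by rewrite -(bcf_tailE b_gt0)// bcf_tail_orbit subKr.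
rewrite /bcf_theta pq bcf_qE -/(Q n).
(* The values of the Moebius map at 0 and at [t n] differ by the determinant times [t n] over the
   product of the denominators. *)
have -> : x - (1 - (contP b n).2%:~R / Q n) =
    - (((contP b n).2%:~R * Q' n - (contP b n).1%:~R * Q n) * t n /
       (Q n * (Q n - Q' n * t n))).
  by rewrite {1}xE; field; rewrite !lt0r_neq0.
rewrite det mul1r normrN ger0_norm; last by rewrite divr_ge0// mulr_ge0// ltW.
by field; rewrite !lt0r_neq0.
Qed.

Lemma bcf_theta_sub_lt1 n : bcf_orbit x n.+1 != 0 ->
  `|bcf_theta x n.+1 - bcf_theta x n| < 1.
Proof.
move=> o0; have /andP[o1 o2] := bcf_orbit_itv n.+1 x01.
have {o1}o1 : 0 < bcf_orbit x n.+1 by rewrite lt_neqAle eq_sym o0.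
have /andP[q1 q2] := contQ_bounds b_gt0 n.
have /andP[_ q3] := contQ_bounds b_gt0 n.+1.
have Q0 : 0 < Q n by rewrite ltr0z (le_lt_trans q1).
have QS : Q n < Q n.+1 by rewrite ltr_int.
have Q'S : Q' n.+1 = Q n by [].
have QE : Q n.+1 = ((b n.+1)%:~R + 1) * Q n - Q' n.
  by rewrite /Q /Q' /= -/(contQ b) intrB intrM intrD.
have tE : t n = ((b n.+1)%:~R + 1 - t n.+1)^-1.
  by rewrite /t (bcf_orbitS n x01) subKr; congr _^-1; rewrite /b; ring.
have b1 : 1 <= (b n.+1)%:~R :> R by rewrite ler1z -gtz0_ge1.
have T0 : 0 < t n.+1 by rewrite /t; lra.
have T1 : t n.+1 < 1 by rewrite /t; lra.
have D0 : 0 < Q n.+1 - Q n * t n.+1 by nra.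
have E0 : 0 < (b n.+1)%:~R + 1 - t n.+1 by lra.
have -> : bcf_theta x n.+1 - bcf_theta x n =
    (Q n.+1 * t n.+1 - Q n) / (Q n.+1 - Q n * t n.+1).
  rewrite !bcf_thetaE Q'S tE.
  (* Multiplied by [b n.+1 + 1 - t n.+1], the denominator of theta_n becomes that of theta_(n+1);
     [field] meets it in two shapes. *)
  have N0 : ((b n.+1)%:~R + 1 - t n.+1) * Q n - Q' n != 0.
    apply: contraTneq D0 => e; rewrite -leNgt QE le_eqVlt; apply/orP; left.
    by apply/eqP; rewrite -[RHS]e; ring.
  have N1 : ((b n.+1)%:~R + 1) * Q n - Q' n - Q n * t n.+1 != 0 by rewrite -QE lt0r_neq0.
  by rewrite QE; field; rewrite ?N0 ?N1 ?(lt0r_neq0 E0).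
(* Denominator plus and minus numerator factor as (Q_(n+1) - Q_n)(1 + t') and (Q_(n+1) + Q_n)(1 -
   t'). *)
rewrite ltr_norml ltr_pdivlMr// ltr_pdivrMr//; apply/andP; split; nra.
Qed.

End Theta.

(** * Rationality along orbits and small irrationals *)

Lemma bcf_orbit_rational (R : realType) (x : R) n : 0 < x < 1 ->
  rational (bcf_orbit x n) -> rational x.
Proof.
move=> x01; elim: n => [//|n IHn] [q _ qE]; apply: IHn.
exists (1 - ((bcf_digit x n.+1)%:~R + q)^-1) => //.
by rewrite (bcf_orbitS n x01) -qE rmorphB fmorphV rmorphD rmorph1 /= ratr_int.
Qed.

Lemma sqrt2_irrational (R : realType) : irrational (Num.sqrt 2 : R).
Proof.
move=> [q _ qE].
have q2 : q ^+ 2 = 2.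
  by apply: (fmorph_inj (@ratr R)); rewrite rmorphXn /= qE sqr_sqrtr// ratr_nat.
have : numq q ^+ 2 = 2 * denq q ^+ 2.
  apply: (@intr_inj rat); rewrite !expr2 !intrM -!expr2 -[2%:~R]q2.
  by rewrite -[in q ^+ 2](divq_num_den q) expr_div_n divfK// expf_neq0// intr_eq0 denq_neq0.
(* The 2-adic valuation is even on one side and odd on the other. *)
move/(congr1 absz); rewrite abszM !abszX => /(congr1 (logn 2)) /esym /(congr1 odd).
rewrite lognM ?expn_gt0 ?absz_gt0 ?denq_neq0// !lognX oddD !oddM /=.
by [].
Qed.

Lemma irrational_lt (R : realType) (e : R) : 0 < e ->
  exists2 x : R, irrational x & 0 < x < e.
Proof.
move=> e0; pose N := (Num.bound (2 / e)).+1.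
have eN : 2 / e < N%:R.
  rewrite (lt_trans (archi_boundP _))// ?ltr_nat//; first by rewrite divr_ge0 ?ltW.
have s0 : 0 < Num.sqrt 2 :> R by rewrite sqrtr_gt0.
have s2 : Num.sqrt 2 ^+ 2 = 2 :> R by rewrite sqr_sqrtr.
exists (Num.sqrt 2 / N%:R).
  move=> [q _ qE]; apply: (@sqrt2_irrational R); exists (q * N%:R) => //.
  by rewrite rmorphM /= qE ratr_nat divfK// pnatr_eq0.
rewrite divr_gt0//= ?ltr0n// ltr_pdivrMr ?ltr0n//.
move: eN; rewrite ltr_pdivrMr// mulrC; apply: lt_trans; nra.
Qed.

(** * Points near 0, whose first n digits are 1 *)

Section SmallPoint.
Variables (R : realType) (x : R) (n : nat).
Hypotheses (x0 : 0 < x) (xn : 2 * n.+1%:R * x < 1).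

Let den_gt0 i : (i <= n.+1)%N -> 0 < 1 - i%:R * x.
Proof.
rewrite -(ler_nat R) -(ler_pM2r x0) => h.
move: xn h; rewrite -mulrA; move: (n.+1%:R * x) (i%:R * x) => u v *; lra.
Qed.

Let orbit_ratio i : (i < n)%N -> bcf_orbit x i = x / (1 - i%:R * x) ->
  bcf_orbit x i / (1 - bcf_orbit x i) = x / (1 - i.+1%:R * x).
Proof.
move=> lt_in ->; have d1 := den_gt0 (leqW lt_in).
have d0 := den_gt0 (leqW (ltnW lt_in)).
by rewrite -natr1 in d1 *; field; rewrite (lt0r_neq0 d0) (lt0r_neq0 d1).
Qed.

Let ratio_floor i : (i < n)%N -> Num.floor (x / (1 - i.+1%:R * x)) = 0.
Proof.
move=> lt_in; have d1 := den_gt0 (leqW lt_in).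
apply: floor_def; rewrite divr_ge0 ?(ltW x0) ?(ltW d1)//= ltr_pdivrMr//.
(* The ratio is below 1 exactly when [1 - i.+2 * x > 0], hence the range of [den_gt0] up to
   [n.+1]. *)
have := @den_gt0 i.+2 lt_in; rewrite -[i.+2%:R]natr1; lra.
Qed.

(** While the floors vanish the map is x / (1 - x), which lowers 1 / x by 1. *)
Lemma bcf_orbit_small i : (i <= n)%N -> bcf_orbit x i = x / (1 - i%:R * x).
Proof.
elim: i => [_|i IHi lt_in]; first by rewrite mul0r subr0 divr1.
rewrite /bcf_orbit iterS -/(bcf_orbit x i) /bcf_map orbit_ratio ?IHi ?(ltnW lt_in)//.
by rewrite ratio_floor ?subr0.
Qed.

Lemma bcf_digit_small i : (0 < i <= n)%N -> bcf_digit x i = 1.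
Proof.
case: i => // i /= lt_in.
by rewrite /bcf_digit /= orbit_ratio ?bcf_orbit_small ?ratio_floor ?(ltnW lt_in).
Qed.

Lemma bcf_fraction_nseq1 m : bcf_fraction (nseq m 1) = 1 - m.+1%:R^-1.
Proof.
elim: m => [|m IHm]; first by rewrite /= subrr.
rewrite /= IHm -[m.+2%:R]natr1.
have : m.+1%:R != 0 :> rat by rewrite pnatr_eq0.
have : m.+1%:R + 1 != 0 :> rat by rewrite natr1 pnatr_eq0.
by move: m.+1%:R => z z1 z0; field; rewrite z0 z1.
Qed.

Lemma bcf_convergent_small : bcf_convergent x n = n.+1%:R^-1.
Proof.
rewrite /bcf_convergent (_ : map _ _ = nseq n 1) ?bcf_fraction_nseq1 ?subKr//.
transitivity [seq (1 : int) | i <- iota 1 n].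
  by apply/eq_in_map => i; rewrite mem_iota add1n ltnS; exact: bcf_digit_small.
by rewrite -[n in nseq n _](size_iota 1); elim: (iota 1 n) => //= ? ? ->.
Qed.

Lemma bcf_theta_small : n.+1%:R / 2 < bcf_theta x n.
Proof.
have q : bcf_q x n = n.+1 by rewrite /bcf_q bcf_convergent_small pmulrn denqVz.
have -> : bcf_theta x n = n.+1%:R ^+ 2 * `|x - n.+1%:R^-1|.
  rewrite /bcf_theta; congr (_ ^+ 2 * `|x - _|); first by rewrite q.
  transitivity (ratr (bcf_convergent x n) : R).
    by rewrite -[in RHS](divq_num_den (bcf_convergent x n)) fmorph_div /= !ratr_int.
  by rewrite bcf_convergent_small fmorphV /= ratr_nat.
have n0 : 0 < n.+1%:R :> R by rewrite ltr0n.
have n1 : n.+1%:R * n.+1%:R^-1 = 1 :> R by rewrite divff// lt0r_neq0.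
rewrite distrC; apply: lt_le_trans (ler_wpM2l _ (ler_norm _)); last by rewrite exprn_ge0// ltW.
rewrite mulrBr expr2 -!mulrA n1 mulr1 ltrBrDl.
by move: xn n0; move: (n.+1%:R : R) => z xz z0; nra.
Qed.

End SmallPoint.

Theorem mainTheorem2 (R : realType) :
  (~ exists C : R, forall (x : R) (n : nat),
       irrational x -> 0 < x < 1 -> (1 <= n)%N -> bcf_theta x n < C)
  /\
  (forall (x : R) (n : nat),
     irrational x -> 0 < x < 1 -> (1 <= n)%N ->
     `|bcf_theta x n.+1 - bcf_theta x n| < 1).
Proof.
(* For the gap bound, an orbit point equal to 0 would make x rational. *)
split=> [[C thC]|x n xi x01 _]; last first.
  apply: bcf_theta_sub_lt1 => //; apply: contra_notN xi => /eqP o0.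
  by apply: (@bcf_orbit_rational _ x n.+1) => //; exists 0; rewrite ?rmorph0.
(* Chosen so that (n + 1) / 2 exceeds C; the successor ensures n >= 1. *)
pose n := (Num.bound `|C * 2|).+1.
have Cn : C * 2 < n.+1%:R.
  apply: le_lt_trans (ler_norm _) _; apply: lt_le_trans (archi_boundP _) _ => //.
  by rewrite ler_nat /n; exact: leqW (leqnSn _).
have n2 : 0 < 2 * n.+1%:R :> R by rewrite mulr_gt0 ?ltr0n.
have [x xi /andP[x0]] : exists2 x : R, irrational x & 0 < x < (2 * n.+1%:R)^-1.
  by apply: irrational_lt; rewrite invr_gt0.
rewrite -[_^-1]mul1r ltr_pdivlMr// mulrC => xn.
have n1 : 1 <= n.+1%:R :> R by rewrite ler1n.
have x1 : x < 1 by move: xn n1; move: (n.+1%:R : R) => z *; nra.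
have := thC x n xi; rewrite x0 x1 => /(_ isT isT).
by have := bcf_theta_small x0 xn; lra.
Qed.
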